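(* Let $p\in\mathbb{R}[\boldsymbol{x}]$, let $\mathcal{I}\subset\mathbb{R}[\boldsymbol{x}]$ be an ideal, and let $\boldsymbol{h}=(h_1,\dots,h_m)$ be a tuple of $\mathcal{I}$-spherical polynomials and $\kappa\in\mathbb{N}$ such that $p+\mathcal{I}\in U_{2k,\mathcal{I}}(\boldsymbol{h})$ for all $k\ge\kappa$. Fix a basis $\boldsymbol{z}_{2\kappa}+\mathcal{I}$ of $U_{2\kappa,\mathcal{I}}(\boldsymbol{h})$ and, for each $k\ge\kappa$, let $\boldsymbol{M}_k:\mathbb{R}^{d_{2\kappa}}\to\mathbb{S}^{d_k}$ be the linear map, and $\boldsymbol{M}_k(1)$ the Gram matrix of the polynomial $1$, produced by the Iterative Construction (initialized by Method 1 or Method 2 with $\boldsymbol{M}_\kappa(1)\succ0$). Define $$\mathcal{C}=\{\boldsymbol{z}_{2\kappa}(\boldsymbol{x}):\boldsymbol{x}\in V_{\mathbb{R}}(\mathcal{I})\}\subset\mathbb{R}^{d_{2\kappa}},\qquad \mathcal{S}_k=\{\boldsymbol{M}_k^\star(\boldsymbol{X}):\ \boldsymbol{X}\in\mathbb{S}^{d_k},\ \langle\boldsymbol{M}_k(1),\boldsymbol{X}\rangle=1,\ \boldsymbol{X}\succeq0\}\subset\mathbb{R}^{d_{2\kappa}}\quad(k\ge\kappa),$$ where $\boldsymbol{M}_k^\star$ is the adjoint of $\boldsymbol{M}_k$. Then for all $k\ge\kappa$, $$\mathcal{C}\subset\mathcal{S}_{k+1}\subset\mathcal{S}_k .$$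
   Context: $\mathbb{R}[\boldsymbol{x}]$ is the polynomial ring in $\boldsymbol{x}=(x_1,\dots,x_n)$; $\mathbb{N}$ is the set of nonnegative integers. For an ideal $\mathcal{I}$, $f\equiv_{\mathcal{I}}g$ means $f-g\in\mathcal{I}$ (entrywise for tuples), and $V_{\mathbb{R}}(\mathcal{I})$ is the set of common real zeros of $\mathcal{I}$. For a tuple $\boldsymbol{z}$ of polynomials, $\boldsymbol{z}+\mathcal{I}$ is the tuple of classes mod $\mathcal{I}$. $\mathbb{S}^d$ is the space of real symmetric $d\times d$ matrices with inner product $\langle A,B\rangle=\mathrm{tr}(AB)$; adjoints are taken with respect to this and the Euclidean inner product. Polynomials $h_1,\dots,h_m$ are $\mathcal{I}$-spherical if $\sum_{i=1}^m h_i^2\equiv_{\mathcal{I}}1$. $U_{k,\mathcal{I}}(\boldsymbol{h})=\mathrm{span}\{h_{i_1}\cdots h_{i_k}+\mathcal{I}: i_1,\dots,i_k\in\{1,\dots,m\}\}\subset\mathbb{R}[\boldsymbol{x}]/\mathcal{I}$, and $d_k$ is its dimension. $\boldsymbol{h}^{\otimes k}$ is the $k$-fold Kronecker power of $\boldsymbol{h}$ (the vector of all $m^k$ products $h_{i_1}\cdots h_{i_k}$). Initialization. Fix a basis $\boldsymbol{z}_\kappa+\mathcal{I}$ of $U_{\kappa,\mathcal{I}}(\boldsymbol{h})$, and let $\boldsymbol{P}\in\mathbb{R}^{m^\kappa\times d_\kappa}$ be the unique matrix with $\boldsymbol{P}\boldsymbol{z}_\kappa\equiv_{\mathcal{I}}\boldsymbol{h}^{\otimes\kappa}$.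 For $q\in\mathbb{R}[\boldsymbol{x}]$ with $q+\mathcal{I}\in U_{2\kappa,\mathcal{I}}(\boldsymbol{h})$, let $\boldsymbol{Y}(q)$ be the unique matrix of minimal Frobenius norm among all $\boldsymbol{Y}\in\mathbb{S}^{m^\kappa}$ with $q\equiv_{\mathcal{I}}(\boldsymbol{h}^{\otimes\kappa})^T\boldsymbol{Y}\boldsymbol{h}^{\otimes\kappa}$. Method 1: $\boldsymbol{M}_\kappa(q)=\boldsymbol{P}^T\boldsymbol{Y}(q)\boldsymbol{P}$. Method 2: $\boldsymbol{M}_\kappa(q)=\boldsymbol{P}^T\boldsymbol{Y}(q-q_0)\boldsymbol{P}+q_0\boldsymbol{P}^T\boldsymbol{P}$, where $q_0$ is the constant term of $q$. One of the two methods is fixed, and $\boldsymbol{M}_\kappa(1)\succ0$ is required (automatic for Method 2). Iterative Construction. Given level $k\ge\kappa$ with basis $\boldsymbol{z}_k+\mathcal{I}$ of $U_{k,\mathcal{I}}(\boldsymbol{h})$, fix a basis $\boldsymbol{z}_{k+1}+\mathcal{I}$ of $U_{k+1,\mathcal{I}}(\boldsymbol{h})$, let $\boldsymbol{L}_{k+1}\in\mathbb{R}^{md_k\times d_{k+1}}$ be the unique matrix with $\boldsymbol{L}_{k+1}\boldsymbol{z}_{k+1}\equiv_{\mathcal{I}}\boldsymbol{h}\otimes\boldsymbol{z}_k$, and set $\boldsymbol{M}_{k+1}(q)=\boldsymbol{L}_{k+1}^T(\boldsymbol{I}_m\otimes\boldsymbol{M}_k(q))\boldsymbol{L}_{k+1}$,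 where $\boldsymbol{I}_m$ is the $m\times m$ identity. Each $\boldsymbol{M}_k(q)\in\mathbb{S}^{d_k}$ is a Gram matrix of $q$, i.e. $q\equiv_{\mathcal{I}}\boldsymbol{z}_k^T\boldsymbol{M}_k(q)\boldsymbol{z}_k$. Given the fixed basis $\boldsymbol{z}_{2\kappa}+\mathcal{I}=(z_{2\kappa,1},\dots,z_{2\kappa,d_{2\kappa}})+\mathcal{I}$ of $U_{2\kappa,\mathcal{I}}(\boldsymbol{h})$, $\boldsymbol{M}_k$ is viewed as a linear map $\mathbb{R}^{d_{2\kappa}}\to\mathbb{S}^{d_k}$ sending a coefficient vector $\boldsymbol{c}$ to $\boldsymbol{M}_k(q_{\boldsymbol{c}})$ with $q_{\boldsymbol{c}}=\sum_i c_i z_{2\kappa,i}$; in particular the $i$-th standard basis vector is sent to $\boldsymbol{M}_k(z_{2\kappa,i})$. *)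

(* Defs.v *)
From HB Require Import structures.
From mathcomp Require Export all_boot all_order all_algebra.
From mathcomp Require Export boolp classical_sets reals.
From mathcomp Require Export mxtens.
From mathcomp Require Export mpoly.

#[export] Set Implicit Arguments.
#[export] Unset Strict Implicit.
#[export] Unset Printing Implicit Defensive.

Export Order.TTheory GRing.Theory Num.Theory.

#[export] Set Warnings "-notation-overridden".
Open Scope ring_scope.
Open Scope classical_set_scope.

Section Matrices.
Variable R : realType.

Definition psdmx (d : nat) (A : 'M[R]_d) : Prop :=
  A^T = A /\ forall v : 'cV[R]_d, 0 <= (v^T *m A *m v) 0 0.

Definition pdmx (d : nat) (A : 'M[R]_d) : Prop :=
  A^T = A /\ forall v : 'cV[R]_d, v != 0 -> 0 < (v^T *m A *m v) 0 0.

Definition frobenius_norm (a b : nat) (A : 'M[R]_(a, b)) : R :=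
  Num.sqrt (\sum_i \sum_j A i j ^+ 2).

(* [adjoint_value f X y] is the defining identity <f c, X> = <c, y> of
   y = f^*(X), for the inner products <A, B> = tr (A B) on symmetric matrices
   and <c, y> = c^T y on column vectors. Such a y is unique, and it exists
   whenever f is linear. *)
Definition adjoint_value (N d : nat) (f : 'cV[R]_N -> 'M[R]_d)
    (X : 'M[R]_d) (y : 'cV[R]_N) : Prop :=
  forall c : 'cV[R]_N, \tr (f c *m X) = (c^T *m y) 0 0.

(* { f^*(X) : X symmetric, <A, X> = 1, X positive semidefinite } *)
Definition spectrahedral_image (N d : nat) (f : 'cV[R]_N -> 'M[R]_d)
    (A : 'M[R]_d) : set 'cV[R]_N :=
  [set y | exists X : 'M[R]_d,
     [/\ psdmx X, \tr (A *m X) = 1 & adjoint_value f X y]].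

End Matrices.

Section Polynomials.
Variables (R : realType) (n : nat).
Implicit Types (I : set {mpoly R[n]}) (f g : {mpoly R[n]}).

(* The unit ideal is allowed, unlike in ring_quotient's [idealr_closed]. *)
Definition is_ideal I : Prop :=
  [/\ I 0, forall f g, I f -> I g -> I (f + g)
    & forall f g, I g -> I (f * g)].

Definition eqmodI I f g : Prop := I (f - g).

Definition eqmodI_mx I (a b : nat) (A B : 'M[{mpoly R[n]}]_(a, b)) : Prop :=
  forall i j, eqmodI I (A i j) (B i j).

Definition real_zeros I : set ('I_n -> R) :=
  [set x | forall f, I f -> f.@[x] = 0].

Definition cst_mx (a b : nat) (A : 'M[R]_(a, b)) : 'M[{mpoly R[n]}]_(a, b) :=
  map_mx (@mpolyC n R) A.

(* the polynomial \sum_i c_i z_i *)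
Definition lincomb (N : nat) (z : 'cV[{mpoly R[n]}]_N) (c : 'cV[R]_N) :
    {mpoly R[n]} :=
  \sum_i c i 0 *: z i 0.

(* z^T Y z *)
Definition gram_form (N : nat) (z : 'cV[{mpoly R[n]}]_N) (Y : 'M[R]_N) :
    {mpoly R[n]} :=
  (z^T *m cst_mx Y *m z) 0 0.

Definition spherical I (m : nat) (h : 'cV[{mpoly R[n]}]_m) : Prop :=
  eqmodI I (\sum_i h i 0 ^+ 2) 1.

(* The preimage in R[x] of U_{k,I}(h), i.e. the set of f with f + I in the span
   of the classes of the products h_{i_1} ... h_{i_k}. *)
Definition Uspace I (m : nat) (h : 'cV[{mpoly R[n]}]_m) (k : nat) :
    set {mpoly R[n]} :=
  [set f | exists a : k.-tuple 'I_m -> R,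
     eqmodI I f (\sum_(t : k.-tuple 'I_m) a t *: \prod_(i <- t) h i 0)].

(* The classes mod I of the entries of z form a basis of U_{k,I}(h);
   in particular d = d_k. *)
Definition is_basis I (m : nat) (h : 'cV[{mpoly R[n]}]_m) (k d : nat)
    (z : 'cV[{mpoly R[n]}]_d) : Prop :=
  [/\ forall i, Uspace I h k (z i 0),
      forall f, Uspace I h k f -> exists c, eqmodI I f (lincomb z c)
    & forall c, eqmodI I (lincomb z c) 0 -> c = 0].

(* The Kronecker power [h ^t k] has 1 ^ k columns, hence the cast. *)
Definition kron_pow (m : nat) (h : 'cV[{mpoly R[n]}]_m) (k : nat) :
    'cV[{mpoly R[n]}]_(m ^ k) :=
  castmx (erefl, exp1n k) (h ^t k).

Definition is_gram I (N : nat) (z : 'cV[{mpoly R[n]}]_N) (q : {mpoly R[n]})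
    (Y : 'M[R]_N) : Prop :=
  Y^T = Y /\ eqmodI I q (gram_form z Y).

Definition is_min_gram I (N : nat) (z : 'cV[{mpoly R[n]}]_N)
    (q : {mpoly R[n]}) (Y : 'M[R]_N) : Prop :=
  is_gram I z q Y /\
  forall Y' : 'M[R]_N, is_gram I z q Y' -> frobenius_norm Y <= frobenius_norm Y'.

Variant init_method := Method1 | Method2.

Definition init_gram (meth : init_method) (N d : nat) (P : 'M[R]_(N, d))
    (Y : {mpoly R[n]} -> 'M[R]_N) (q : {mpoly R[n]}) : 'M[R]_d :=
  match meth with
  | Method1 => P^T *m Y q *m P
  | Method2 => P^T *m Y (q - (q@_0%MM)%:MP) *m P + q@_0%MM *: (P^T *m P)
  end.

(* M is produced by the iterative construction from level kappa on; the
   components at levels k < kappa are irrelevant. The matrices P, Y q and L k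
   are uniquely determined by their defining properties below. L k stands for
   L_{k+1}. *)
Record gram_construction I (m : nat) (h : 'cV[{mpoly R[n]}]_m) (kappa : nat)
    (meth : init_method) (d : nat -> nat)
    (z : forall k, 'cV[{mpoly R[n]}]_(d k))
    (P : 'M[R]_(m ^ kappa, d kappa))
    (Y : {mpoly R[n]} -> 'M[R]_(m ^ kappa))
    (L : forall k, 'M[R]_(m * d k, d k.+1))
    (M : forall k, {mpoly R[n]} -> 'M[R]_(d k)) : Prop := GramConstruction {
  gc_basis : forall k, (kappa <= k)%N -> is_basis I h k (z k);
  gc_P : eqmodI_mx I (cst_mx P *m z kappa) (kron_pow h kappa);
  gc_Y : forall q, Uspace I h (2 * kappa) q ->
    is_min_gram I (kron_pow h kappa) q (Y q);
  gc_init : forall q, Uspace I h (2 * kappa) q ->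
    M kappa q = init_gram meth P Y q;
  gc_pd : pdmx (M kappa 1);
  gc_L : forall k, (kappa <= k)%N ->
    eqmodI_mx I (cst_mx (L k) *m z k.+1) (h *t z k);
  gc_step : forall k q, (kappa <= k)%N -> Uspace I h (2 * kappa) q ->
    M k.+1 q = (L k)^T *m (1%:M *t M k q) *m L k
}.

(* { z(x) : x in V_R(I) } *)
Definition moment_image I (N : nat) (z : 'cV[{mpoly R[n]}]_N) : set 'cV[R]_N :=
  [set y | exists2 x, real_zeros I x & y = \col_i (z i 0).@[x]].

End Polynomials.

(* Main.v *)
(* Points of the variety are represented by the rank one matrices
   z_k(x) z_k(x)^T, which are feasible because M_k(q) is a Gram matrix of q on
   the real zeros of I. For the second inclusion, if X is feasible at level
   k + 1, then the partial trace over the first factor of L X L^T is feasible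
   at level k and has the same image, since the partial trace is the adjoint
   of A |-> I_m (x) A. *)
Require Import Defs.

(** * Partial traces and positive semidefinite matrices *)

Section PartialTrace.
Context {R : realType}.

Lemma sum_mxtens (V : nmodType) (m n : nat) (F : 'I_(m * n) -> V) :
  \sum_k F k = \sum_i \sum_j F (mxtens_index (i, j)).
Proof.
rewrite pair_big; under [RHS]eq_bigr => ij _ do rewrite -surjective_pairing.
apply: reindex; exists (@mxtens_unindex m n) => k _.
  exact: mxtens_indexK.
exact: mxtens_unindexK.
Qed.

(** The sum of the [m] diagonal blocks of size [n]. Each block takes rows and columns through the
    same index map, so it inherits positive semidefiniteness from [W]. *)
Definition partial_trace (m n : nat) (W : 'M[R]_(m * n)) : 'M[R]_n :=
  \sum_(a < m) mxsub (fun i => mxtens_index (a, i))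
                     (fun j => mxtens_index (a, j)) W.

(** The matrix [1%:M *t A] is block diagonal with all diagonal blocks equal to [A], so the trace
    sees only the diagonal blocks of [W]. *)
Lemma mxtrace_partial (m n : nat) (A : 'M[R]_n) (W : 'M[R]_(m * n)) :
  \tr (A *m partial_trace W) = \tr ((1%:M *t A) *m W).
Proof.
rewrite mulmx_sumr raddf_sum /= {2}/mxtrace sum_mxtens.
apply: eq_bigr => a _; apply: eq_bigr => i _; rewrite !mxE sum_mxtens.
rewrite (bigD1 a) //= [X in _ + X]big1 ?addr0 => [|b ba].
  by apply: eq_bigr => j _; rewrite tensmxE !mxE eqxx mul1r.
by apply: big1 => j _; rewrite tensmxE !mxE eq_sym (negPf ba) !mul0r.
Qed.

Lemma psdmx_congr (m n : nat) (B : 'M[R]_(m, n)) (X : 'M[R]_n) :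
  psdmx X -> psdmx (B *m X *m B^T).
Proof.
move=> [symX posX]; split; first by rewrite !trmx_mul trmxK symX mulmxA.
move=> v; have := posX (B^T *m v).
by rewrite trmx_mul trmxK !mulmxA.
Qed.

Lemma psdmx_sum (n : nat) (T : finType) (F : T -> 'M[R]_n) :
  (forall i, psdmx (F i)) -> psdmx (\sum_i F i).
Proof.
move=> psdF; split.
  by rewrite raddf_sum; apply: eq_bigr => i _; have [] := psdF i.
move=> v; rewrite mulmx_sumr mulmx_suml summxE.
by apply: sumr_ge0 => i _; have [_] := psdF i.
Qed.

Lemma psdmx_mxsub (m n : nat) (f : 'I_m -> 'I_n) (X : 'M[R]_n) :
  psdmx X -> psdmx (mxsub f f X).
Proof.
move=> psdX; suff -> : mxsub f f X = rowsub f 1%:M *m X *m (rowsub f 1%:M)^T.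
  exact: psdmx_congr.
by rewrite mul_rowsub_mx mul1mx trmx_mxsub trmx1 mulmx_colsub mulmx1 -mxsub_comp.
Qed.

Lemma psdmx_partial_trace (m n : nat) (W : 'M[R]_(m * n)) :
  psdmx W -> psdmx (partial_trace W).
Proof. by move=> psdW; apply: psdmx_sum => a; apply: psdmx_mxsub. Qed.

Lemma psdmx_outer (n : nat) (v : 'cV[R]_n) : psdmx (v *m v^T).
Proof.
split; first by rewrite trmx_mul trmxK.
move=> u; rewrite mulmxA -mulmxA mxE big_ord1.
(* The form is a product of two scalars that are transposes of each other, hence a square. *)
suff -> : (v^T *m u) 0 0 = (u^T *m v) 0 0 by rewrite -expr2 sqr_ge0.
by rewrite -[in RHS](trmxK v) -trmx_mul [RHS]mxE.
Qed.

Lemma mxtrace_outer (n : nat) (A : 'M[R]_n) (v : 'cV[R]_n) :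
  \tr (A *m (v *m v^T)) = (v^T *m A *m v) 0 0.
Proof. by rewrite mulmxA mxtrace_mulC mulmxA /mxtrace big_ord1. Qed.

End PartialTrace.

(** * Congruence modulo the ideal and the spans of products of the [h i 0] *)

Section Products.
Context {R : realType} {n : nat} {I : set {mpoly R[n]}}.
Hypothesis idealI : is_ideal I.
Context {m : nat} {h : 'cV[{mpoly R[n]}]_m}.
Implicit Types (f g : {mpoly R[n]}) (k : nat).

Lemma idealD f g : I f -> I g -> I (f + g).
Proof. by case: idealI => _ + _; apply. Qed.

Lemma idealM f g : I g -> I (f * g).
Proof. by case: idealI => _ _; apply. Qed.

Lemma eqmodI_refl f : eqmodI I f f.
Proof. by rewrite /eqmodI subrr; case: idealI. Qed.

Lemma eqmodI_sym f g : eqmodI I f g -> eqmodI I g f.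
Proof. by move=> /(idealM (-1)); rewrite mulN1r opprB. Qed.

Lemma eqmodI_trans f g e : eqmodI I f g -> eqmodI I g e -> eqmodI I f e.
Proof. by move=> fg /(idealD fg); rewrite addrA subrK. Qed.

Lemma eqmodI_add f f' g g' :
  eqmodI I f f' -> eqmodI I g g' -> eqmodI I (f + g) (f' + g').
Proof. by rewrite /eqmodI opprD addrACA; apply: idealD. Qed.

Lemma eqmodI_mul f g g' : eqmodI I g g' -> eqmodI I (f * g) (f * g').
Proof. by rewrite /eqmodI -mulrBr; apply: idealM. Qed.

Lemma Uspace_eqmod k f g : eqmodI I f g -> Uspace I h k g -> Uspace I h k f.
Proof. by move=> fg [a ga]; exists a; apply: eqmodI_trans ga. Qed.

Lemma Uspace0 k : Uspace I h k 0.
Proof.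
exists (fun=> 0); rewrite big1 => [|t _]; last exact: scale0r.
exact: eqmodI_refl.
Qed.

Lemma UspaceD k f g : Uspace I h k f -> Uspace I h k g -> Uspace I h k (f + g).
Proof.
move=> [a fa] [b gb]; exists (fun t => a t + b t).
under eq_bigr => t _ do rewrite scalerDl.
by rewrite big_split; apply: eqmodI_add.
Qed.

Lemma UspaceZ k c f : Uspace I h k f -> Uspace I h k (c *: f).
Proof.
move=> [a fa]; exists (fun t => c * a t).
under eq_bigr => t _ do rewrite -scalerA.
by rewrite -scaler_sumr -!mul_mpolyC; apply: eqmodI_mul.
Qed.

Lemma Uspace_sum k (T : finType) (F : T -> {mpoly R[n]}) :
  (forall i, Uspace I h k (F i)) -> Uspace I h k (\sum_i F i).
Proof.
move=> UF; apply: big_ind => [|f g|i _]; last exact: UF.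
  exact: Uspace0.
exact: UspaceD.
Qed.

Lemma Uspace_prod k (t : k.-tuple 'I_m) : Uspace I h k (\prod_(i <- t) h i 0).
Proof.
exists (fun s => (s == t)%:R); rewrite (bigD1 t) //= eqxx scale1r [X in _ + X]big1.
  by rewrite addr0; apply: eqmodI_refl.
by move=> s /negPf ->; rewrite scale0r.
Qed.

Lemma UspaceS k i f : Uspace I h k f -> Uspace I h k.+1 (h i 0 * f).
Proof.
move=> [a fa]; apply: Uspace_eqmod (eqmodI_mul _ fa) _.
rewrite mulr_sumr; apply: Uspace_sum => t.
rewrite -scalerAr; apply: UspaceZ.
by have := Uspace_prod [tuple of i :: t]; rewrite big_cons.
Qed.

(** Writing 1 as the sum of the [h i 0 * (h i 0 * 1)] raises the degree by two; the start is the
    empty product in degree 0. This brings [M k 1] under the rules of the construction. *)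
Lemma Uspace1 k : spherical I h -> Uspace I h (2 * k) 1.
Proof.
move=> sph; elim: k => [|k IHk].
  by have := Uspace_prod [tuple]; rewrite big_nil.
rewrite mulnS; apply: Uspace_eqmod (eqmodI_sym sph) _.
apply: Uspace_sum => i; rewrite expr2 -[X in _ * X]mulr1.
by do 2!apply: UspaceS.
Qed.

Lemma Uspace_lincomb k (N : nat) (z : 'cV[{mpoly R[n]}]_N) c :
  (forall i, Uspace I h k (z i 0)) -> Uspace I h k (lincomb z c).
Proof. by move=> Uz; apply: Uspace_sum => i; apply: UspaceZ. Qed.

End Products.

Definition evmx (R : realType) (n : nat) (x : 'I_n -> R) (a b : nat)
    (A : 'M[{mpoly R[n]}]_(a, b)) : 'M[R]_(a, b) :=
  map_mx (meval x) A.

(** * Evaluation at a real zero of the ideal *)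

Section Evaluation.
Context {R : realType} {n : nat} {I : set {mpoly R[n]}} {x : 'I_n -> R}.
Hypothesis xI : real_zeros I x.

Lemma meval_eqmodI f g : eqmodI I f g -> f.@[x] = g.@[x].
Proof. by move=> /xI/eqP; rewrite mevalB subr_eq0 => /eqP. Qed.

Lemma evmx_eqmodI (a b : nat) (A B : 'M[{mpoly R[n]}]_(a, b)) :
  eqmodI_mx I A B -> evmx x A = evmx x B.
Proof. by move=> AB; apply/matrixP => i j; rewrite !mxE; apply: meval_eqmodI. Qed.

Lemma evmx_cst (a b : nat) (A : 'M[R]_(a, b)) : evmx x (cst_mx n A) = A.
Proof. by apply/matrixP => i j; rewrite !mxE mevalC. Qed.

Lemma evmx_mul (a b c : nat) (A : 'M[{mpoly R[n]}]_(a, b))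
    (B : 'M[{mpoly R[n]}]_(b, c)) : evmx x (A *m B) = evmx x A *m evmx x B.
Proof. exact: map_mxM. Qed.

Lemma evmx_tr (a b : nat) (A : 'M[{mpoly R[n]}]_(a, b)) :
  evmx x A^T = (evmx x A)^T.
Proof. by rewrite /evmx map_trmx. Qed.

Lemma meval_gram (N : nat) (z : 'cV[{mpoly R[n]}]_N) (Y : 'M[R]_N) :
  (gram_form z Y).@[x] = ((evmx x z)^T *m Y *m evmx x z) 0 0.
Proof.
by rewrite -{2}(evmx_cst Y) -evmx_tr -!evmx_mul [RHS]mxE.
Qed.

Lemma meval_lincomb (N : nat) (z : 'cV[{mpoly R[n]}]_N) (c : 'cV[R]_N) :
  (lincomb z c).@[x] = (c^T *m evmx x z) 0 0.
Proof.
rewrite /lincomb raddf_sum mxE; apply: eq_bigr => i _.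
by rewrite !mxE; exact: mevalZ.
Qed.

Context {m : nat} {h : 'cV[{mpoly R[n]}]_m}.

Lemma evmx_spherical : spherical I h -> (evmx x h)^T *m evmx x h = 1.
Proof.
move=> /meval_eqmodI; rewrite meval1 raddf_sum /= => h1.
apply/matrixP => i j; rewrite !ord1 !mxE eqxx -[RHS]h1.
by apply: eq_bigr => a _; rewrite !mxE expr2 mevalM.
Qed.

(** By the mixed product rule the form is a Kronecker product of two 1 by 1 matrices. For a unit
    vector [u] it reduces level k + 1 to level k. *)
Lemma tens_cV_norm (a b : nat) (u : 'cV[R]_a) (v : 'cV[R]_b) (A : 'M[R]_b) :
  (((u *t v)^T *m (1%:M *t A) *m (u *t v)) : 'M_(1 * 1)) 0 0 =
  (u^T *m u) 0 0 * (v^T *m A *m v) 0 0.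
Proof.
rewrite trmx_tens !tensmx_mul mulmx1 [LHS]mxE.
by rewrite !ord1.
Qed.

(** Euclidean norms multiply under Kronecker products. The column index [j] is arbitrary because
    [1 ^ k] is only provably 1. *)
Lemma ntensmx_norm (k : nat) (u : 'cV[R]_m) (j : 'I_(1 ^ k)) :
  \sum_i u i 0 ^+ 2 = 1 -> \sum_i (u ^t k) i j ^+ 2 = 1.
Proof.
move=> u1; case: k j => [|k] j.
  by rewrite big_ord1 /= mxE !ord1 expr1n.
(* For positive exponents the recursion starts from [u] itself, not from the identity, so the
   induction starts at exponent 1. *)
rewrite /ntensmx; elim: k j => [|k IHk] j.
  by rewrite -[RHS]u1; apply: eq_bigr => i _; rewrite [j]ord1.
case: (mxtens_indexP j) => j1 j2.
rewrite [LHS](@sum_mxtens R m (m ^ k.+1)) /= -[RHS]u1.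
apply: eq_bigr => a _; under eq_bigr => b _ do rewrite tensmxE exprMn.
by rewrite -mulr_sumr IHk mulr1 [j1]ord1.
Qed.

Lemma evmx_ntensmx (k : nat) : evmx x (h ^t k) = evmx x h ^t k.
Proof.
case: k => [|k]; first exact: map_mx1.
rewrite /ntensmx; elim: k => [|k IHk] //=.
by rewrite -IHk; apply: map_mxT.
Qed.

(** This makes the correction term of [Method2], the constant term times [P^T *m P], evaluate to the
    constant term. *)
Lemma evmx_kron_pow (k : nat) : spherical I h ->
  ((evmx x (kron_pow h k))^T *m evmx x (kron_pow h k)) 0 0 = 1.
Proof.
move=> /evmx_spherical/(congr1 (fun A : 'M_1 => A 0 0)).
rewrite !mxE eqxx => h1.
have u1 : \sum_i evmx x h i 0 ^+ 2 = 1.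
  by rewrite -[RHS]h1; apply: eq_bigr => i _; rewrite !mxE.
rewrite -(ntensmx_norm (cast_ord (esym (exp1n k)) 0) u1) -evmx_ntensmx.
apply: eq_bigr => i _.
by rewrite !mxE -expr2 castmxE /= cast_ord_id.
Qed.

End Evaluation.

(** * Gram matrices along the construction and the two inclusions *)

Section Construction.
Context {R : realType} {n : nat} {I : set {mpoly R[n]}} {m : nat}.
Context {h : 'cV[{mpoly R[n]}]_m} {kappa : nat} {meth : init_method}.
Context {d : nat -> nat} {z : forall k : nat, 'cV[{mpoly R[n]}]_(d k)}.
Context {P : 'M[R]_(m ^ kappa, d kappa)}.
Context {Y : {mpoly R[n]} -> 'M[R]_(m ^ kappa)}.
Context {L : forall k : nat, 'M[R]_(m * d k, d k.+1)}.
Context {M : forall k : nat, {mpoly R[n]} -> 'M[R]_(d k)}.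
Hypothesis idealI : is_ideal I.
Hypothesis sph : spherical I h.
Hypothesis hM : gram_construction I h meth z P Y L M.

Lemma init_gram_eval (x : 'I_n -> R) (q : {mpoly R[n]}) :
  real_zeros I x -> Uspace I h (2 * kappa) q ->
  ((evmx x (z kappa))^T *m M kappa q *m evmx x (z kappa)) 0 0
    = q.@[x].
Proof.
move=> xI Uq; rewrite (gc_init hM Uq).
set v := evmx x (z kappa); set w := evmx x (kron_pow h kappa).
have Pv : P *m v = w.
  by rewrite /w -(evmx_eqmodI xI (gc_P hM)) evmx_mul evmx_cst.
(* Conjugation by [P] turns forms in the Kronecker power into forms in the basis [z kappa]. *)
have quadP (A : 'M_(m ^ kappa)) :
    v^T *m (P^T *m A *m P) *m v = w^T *m A *m w.
  by rewrite -Pv trmx_mul !mulmxA.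
have Yw f : Uspace I h (2 * kappa) f -> (w^T *m Y f *m w) 0 0 = f.@[x].
  move=> /(gc_Y hM)[[_ /(meval_eqmodI xI) ->] _].
  by rewrite meval_gram.
case: meth; rewrite /init_gram.
  by rewrite quadP Yw.
(* Using [Yw] on [q] minus its constant term requires that constants lie in the span of degree
   [2 * kappa]; sphericity provides this. *)
set q0 := q@_0%MM; rewrite mulmxDr mulmxDl quadP mxE Yw; last first.
  rewrite -alg_mpolyC -scaleNr; apply: UspaceD => //; apply: UspaceZ => //.
  exact: Uspace1.
rewrite -scalemxAr -scalemxAl -[P^T]mulmx1 quadP mulmx1 mxE.
by rewrite (evmx_kron_pow xI) // mevalB mevalC mulr1 subrK.
Qed.

Lemma gram_eval (x : 'I_n -> R) (k : nat) (q : {mpoly R[n]}) :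
  real_zeros I x -> (kappa <= k)%N -> Uspace I h (2 * kappa) q ->
  ((evmx x (z k))^T *m M k q *m evmx x (z k)) 0 0 = q.@[x].
Proof.
move=> xI + Uq; elim: k => [|k IHk].
  (* The induction runs over all naturals, so the initial level occurs either here, as [kappa = 0],
     or below, as [kappa = k.+1]. *)
  by rewrite leqn0 => /eqP k0; move: k0 (init_gram_eval xI Uq) => ->.
rewrite leq_eqVlt => /orP[/eqP k1|lek].
  by move: k1 (init_gram_eval xI Uq) => ->.
rewrite (gc_step hM) //.
have Lz : L k *m evmx x (z k.+1) = evmx x h *t evmx x (z k).
  rewrite -{1}(evmx_cst (x := x) (L k)) -evmx_mul.
  by rewrite (evmx_eqmodI xI (gc_L hM lek)); exact: (map_mxT (meval x) h (z k)).
rewrite !mulmxA -trmx_mul -mulmxA Lz.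
by rewrite [LHS]tens_cV_norm (evmx_spherical xI sph) mxE mul1r IHk.
Qed.

Lemma spectrahedral_image_sub (N k : nat) (z2 : 'cV[{mpoly R[n]}]_N) :
  (forall i, Uspace I h (2 * kappa) (z2 i 0)) -> (kappa <= k)%N ->
  spectrahedral_image (fun c => M k.+1 (lincomb z2 c)) (M k.+1 1) `<=`
  spectrahedral_image (fun c => M k (lincomb z2 c)) (M k 1).
Proof.
move=> Uz lek y [X [psdX trX adjX]].
(* Taking [q = 1] transfers the normalisation, and [q = lincomb z2 c] the adjoint identity. *)
have trM q : Uspace I h (2 * kappa) q ->
    \tr (M k q *m partial_trace (L k *m X *m (L k)^T)) = \tr (M k.+1 q *m X).
  move=> Uq; rewrite mxtrace_partial (gc_step hM) // !mulmxA.
  by rewrite mxtrace_mulC !mulmxA.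
exists (partial_trace (L k *m X *m (L k)^T)); split.
- exact/psdmx_partial_trace/psdmx_congr.
- by rewrite trM //; apply: Uspace1.
- by move=> c; rewrite trM //; apply: Uspace_lincomb.
Qed.

Lemma moment_image_sub (N k : nat) (z2 : 'cV[{mpoly R[n]}]_N) :
  (forall i, Uspace I h (2 * kappa) (z2 i 0)) -> (kappa <= k)%N ->
  moment_image I z2 `<=`
  spectrahedral_image (fun c => M k (lincomb z2 c)) (M k 1).
Proof.
move=> Uz lek y [x xI ->]; pose v := evmx x (z k).
exists (v *m v^T); split; first exact: psdmx_outer.
  (* Pairing with [v *m v^T] evaluates the represented polynomial at [x]: the polynomial 1 gives the
     normalisation, and [lincomb z2 c] gives the pairing of [c] with the point of the moment
     image. *)
  by rewrite mxtrace_outer gram_eval ?meval1 //; apply: Uspace1.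
move=> c; rewrite mxtrace_outer gram_eval //; last exact: Uspace_lincomb.
rewrite meval_lincomb; congr ((_ *m _) 0 0).
by apply/matrixP => i j; rewrite !mxE ord1.
Qed.

End Construction.

Theorem lemma5p1 (R : realType) (n : nat) (p : {mpoly R[n]})
  (I : set {mpoly R[n]}) (hI : is_ideal I)
  (m : nat) (h : 'cV[{mpoly R[n]}]_m) (hsph : spherical I h)
  (kappa : nat)
  (hp : forall k : nat, (kappa <= k)%N -> Uspace I h (2 * k) p)
  (N : nat) (z2 : 'cV[{mpoly R[n]}]_N) (hz2 : is_basis I h (2 * kappa) z2)
  (meth : init_method) (d : nat -> nat)
  (z : forall k : nat, 'cV[{mpoly R[n]}]_(d k))
  (P : 'M[R]_(m ^ kappa, d kappa))
  (Y : {mpoly R[n]} -> 'M[R]_(m ^ kappa))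
  (L : forall k : nat, 'M[R]_(m * d k, d k.+1))
  (M : forall k : nat, {mpoly R[n]} -> 'M[R]_(d k))
  (hM : gram_construction I h meth z P Y L M) :
  let C : set 'cV[R]_N := moment_image I z2 in
  let S (k : nat) : set 'cV[R]_N :=
    spectrahedral_image (fun c : 'cV[R]_N => M k (lincomb z2 c)) (M k 1) in
  forall k : nat, (kappa <= k)%N -> C `<=` S k.+1 /\ S k.+1 `<=` S k.
Proof.
move=> C S k lek; have [Uz _ _] := hz2; split.
  by apply: (moment_image_sub hI hsph hM Uz); apply: leqW.
exact: (spectrahedral_image_sub hI hsph hM Uz).
Qed.
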